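(* Let $M$ be a smooth manifold. The assignment $(\pi,\varphi)\mapsto(\pi^{!},\varphi)$ is a one-to-one correspondence (bijection) from the set of pairs $(\pi,\varphi)$ consisting of a Poisson structure $\pi\in\Gamma(\Lambda^{2}TM)$ on $M$ and a Poisson isomorphism $\varphi:M\to M$ for $\pi$, onto the set of Hom-Poisson structures on $M$.
   Context: A Poisson isomorphism for $\pi$ is a diffeomorphism $\varphi:M\to M$ with $\varphi_{*}\pi=\pi$. Let $\varphi:M\to M$ be a diffeomorphism, and $\varphi^{*}f:=f\circ\varphi$ for $f\in C^{\infty}(M)$. $\varphi^{!}TM$ is the pull-back bundle of $TM$ along $\varphi$. A section $X\in\Gamma(\varphi^{!}TM)$ acts on functions by $(X(f))(p)=\langle (df)_{\varphi(p)},X_{p}\rangle$; thus $\Gamma(\varphi^{!}TM)$ is identified with the linear maps $X$ on $C^\infty(M)$ such that $X(fg)=X(f)\varphi^{*}g+\varphi^{*}f\,X(g)$. Define $$\mathrm{Ad}_{\varphi^{*}}X:=\varphi^{*}\circ X\circ(\varphi^{*})^{-1},$$ $$[X,Y]_{\varphi^{*}}:=\varphi^{*}\circ X\circ(\varphi^{*})^{-1}\circ Y\circ(\varphi^{*})^{-1}-\varphi^{*}\circ Y\circ(\varphi^{*})^{-1}\circ X\circ(\varphi^{*})^{-1}$$ for $X,Y\in\Gamma(\varphi^{!}TM)$. The map $\mathrm{Ad}_{\varphi^{*}}$ extends to $\Gamma(\Lambda^{\bullet}\varphi^{!}TM)$ by $\mathrm{Ad}_{\varphi^*}(f)=\varphi^{*}f$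 on functions and $\mathrm{Ad}_{\varphi^*}(D_1\wedge D_2)=\mathrm{Ad}_{\varphi^*}(D_1)\wedge\mathrm{Ad}_{\varphi^*}(D_2)$. The Hom-Schouten bracket $[\cdot,\cdot]_{\varphi^{*}}:\Gamma(\Lambda^{k}\varphi^{!}TM)\times\Gamma(\Lambda^{l}\varphi^{!}TM)\to\Gamma(\Lambda^{k+l-1}\varphi^{!}TM)$ is the unique bilinear extension of the bracket on $\Gamma(\varphi^{!}TM)$ such that $[f,g]_{\varphi^{*}}=0$, $[X,f]_{\varphi^{*}}=(\mathrm{Ad}_{\varphi^{*}}X)(f)$, $[D_1,D_2\wedge D_3]_{\varphi^*}=[D_1,D_2]_{\varphi^*}\wedge\mathrm{Ad}_{\varphi^*}(D_3)+(-1)^{(k+1)l}\mathrm{Ad}_{\varphi^*}(D_2)\wedge[D_1,D_3]_{\varphi^*}$ and $[D_1,D_2]_{\varphi^*}=-(-1)^{(k-1)(l-1)}[D_2,D_1]_{\varphi^*}$, for $f,g\in C^\infty(M)$, $X\in\Gamma(\varphi^!TM)$, $D_1$ of degree $k$, $D_2$ of degree $l$ and $D_3$ of arbitrary degree. A Hom-Poisson structure on $M$ is a pair $(\pi',\varphi)$, where $\varphi:M\to M$ is a diffeomorphism and $\pi'\in\Gamma(\Lambda^{2}\varphi^{!}TM)$ satisfies $[\pi',\pi']_{\varphi^{*}}=0$ and $\mathrm{Ad}_{\varphi^{*}}(\pi')=\pi'$. For $\pi\in\Gamma(\Lambda^{2}TM)$ and a diffeomorphism $\varphi$, the pull-back section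 $\pi^{!}\in\Gamma(\Lambda^{2}\varphi^{!}TM)$ is given by $\pi^{!}_{p}:=\pi_{\varphi(p)}$, $p\in M$. *)

(* Defs.v *)
From mathcomp Require Import all_boot all_order all_algebra.
From mathcomp Require Import all_classical all_reals all_analysis.

Set Implicit Arguments.
Unset Strict Implicit.
Unset Printing Implicit Defensive.
Import Order.TTheory GRing.Theory Num.Theory.
Import numFieldNormedType.Exports.
Local Open Scope classical_set_scope.
Local Open Scope ring_scope.

(** * Smooth functions on open subsets of R^n *)

Section Euclidean.
Variables (R : realType) (n : nat).

(* [U] is meant to be open: the differentiability of [f] at the points of [U]
   then only depends on the restriction of [f] to [U]. *)
Fixpoint Ck (k : nat) (U : set 'rV[R]_n) (f : 'rV[R]_n -> R) : Prop :=
  if k is k'.+1 then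
    (forall x, U x -> differentiable f x) /\
    (forall i : 'I_n, Ck k' U (fun x => 'D_(delta_mx 0 i) f x))
  else forall x, U x -> {for x, continuous f}.

Definition smooth_on (U : set 'rV[R]_n) (f : 'rV[R]_n -> R) : Prop :=
  forall k, Ck k U f.

Definition vsmooth_on m (U : set 'rV[R]_n) (f : 'rV[R]_n -> 'rV[R]_m) : Prop :=
  forall i : 'I_m, smooth_on U (fun x => f x 0 i).

End Euclidean.

(** * Smooth manifolds, smooth functions and diffeomorphisms *)

(* Only the values of [cfun] on [cdom] and of [cinv] on [cfun @` cdom] are
   meaningful. *)
Record chart (R : realType) (n : nat) (M : Type) := Chart {
  cdom : set M;
  cfun : M -> 'rV[R]_n;
  cinv : 'rV[R]_n -> M }.

Record is_chart (R : realType) (n : nat) (M : topologicalType)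
    (c : chart R n M) : Prop := IsChart {
  chart_open_dom : open (cdom c);
  chart_open_img : open (cfun c @` cdom c);
  chart_cancel : forall p, cdom c p -> cinv c (cfun c p) = p;
  chart_cts : {within cdom c, continuous (cfun c)};
  chart_inv_cts : {within cfun c @` cdom c, continuous (cinv c)} }.

Record manifold (R : realType) (n : nat) := Manifold {
  msort :> topologicalType;
  m_hausdorff : hausdorff_space msort;
  m_second_countable : exists2 S : set_system msort, countable S & basis S;
  atlas : set (chart R n msort);
  atlas_chart : forall c, atlas c -> is_chart c;
  atlas_cover : forall p, exists2 c, atlas c & cdom c p;
  atlas_compat : forall c c', atlas c -> atlas c' ->
    vsmooth_on (cfun c @` (cdom c `&` cdom c')) (cfun c' \o cinv c) }.

Section Manifold.
Variables (R : realType) (n : nat) (M : manifold R n).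

Definition Cinf : set (M -> R) :=
  [set f : M -> R |
  forall c, atlas c -> smooth_on (cfun c @` cdom c) (f \o cinv c)].

Definition smooth_map (phi : M -> M) : Prop :=
  continuous phi /\
  forall c c', atlas c -> atlas c' ->
    vsmooth_on (cfun c @` (cdom c `&` phi @^-1` cdom c'))
               (cfun c' \o phi \o cinv c).

Record diffeo := Diffeo {
  dfun :> M -> M;
  dinv : M -> M;
  dfunK : cancel dfun dinv;
  dinvK : cancel dinv dfun;
  dfun_smooth : smooth_map dfun;
  dinv_smooth : smooth_map dinv }.

Lemma diffeo_ext (phi psi : diffeo) : dfun phi = dfun psi -> phi = psi.
Proof.
case: phi psi => [f f' fK f'K sf sf'] [g g' gK g'K sg sg'] /= e.
case: _ / e g' gK g'K sg sg' => g' gK g'K sg sg'.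
have e : f' = g' by apply/funext => x; rewrite -[x in RHS]f'K gK.
case: _ / e gK g'K sg' => gK g'K sg'.
congr Diffeo; exact: Prop_irrelevance.
Qed.

Lemma smooth_map_id : smooth_map id.
Proof.
split=> [|c c' cM c'M]; first by move=> x; exact: cvg_id.
exact: atlas_compat.
Qed.

Definition diffeo_id : diffeo :=
  @Diffeo id id (fun=> erefl) (fun=> erefl) smooth_map_id smooth_map_id.

Definition pull (phi : M -> M) (f : M -> R) : M -> R := f \o phi.

(** * Tangent vectors, exterior powers and sections *)

(* Tangent vectors at p are the derivations at p of C^oo(M).  They are applied
   to arbitrary functions M -> R; the last clause fixes the irrelevant values
   off C^oo(M), so that equal tangent vectors are equal as functions. *)
Definition tangent (p : M) (v : (M -> R) -> R) : Prop :=
  [/\ forall (a : R) f g, Cinf f -> Cinf g ->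
        v (fun x => a * f x + g x) = a * v f + v g,
      forall f g, Cinf f -> Cinf g ->
        v (fun x => f x * g x) = v f * g p + f p * v g
    & forall f, ~ Cinf f -> v f = 0].

(* v_0 /\ ... /\ v_(k-1), seen through its pairing with df_0 /\ ... /\ df_(k-1),
   that is det (v_i f_j). *)
Definition wedge_vectors k (v : 'I_k -> (M -> R) -> R) (fs : seq (M -> R)) : R :=
  if size fs == k then \det (\matrix_(i < k, j < k) v i (nth (cst 0) fs j))
  else 0.

(* Lambda^k (T_p M): linear combinations of k-fold wedge products of tangent
   vectors at p. *)
Definition ext_power (k : nat) (p : M) : set (seq (M -> R) -> R) := [set P |
  exists (N : nat) (a : 'I_N -> R) (v : 'I_N -> 'I_k -> (M -> R) -> R),
    (forall s i, tangent p (v s i)) /\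
    P = (fun fs => \sum_(s < N) a s * wedge_vectors (v s) fs)].

(* A field of multivectors (along a map): [D p [:: f_1; ...; f_k]] is the value
   of D_p on df_1 /\ ... /\ df_k.  The degree is not part of the type, a field of
   degree k being 0 on the sequences of size different from k. *)
Local Notation mfield := (M -> seq (M -> R) -> R).

(* Gamma (Lambda^k phi^! TM); [sections id k] is Gamma (Lambda^k TM). *)
Definition sections (phi : M -> M) (k : nat) : set mfield := [set D |
  (forall p, ext_power k (phi p) (D p)) /\
  (forall fs, size fs = k ->
     (forall i, (i < k)%N -> Cinf (nth (cst 0) fs i)) ->
     Cinf (fun p => D p fs))].

Definition fun_field (f : M -> R) : mfield :=
  fun p fs => if fs is [::] then f p else 0.

(* Degree 1 fields versus linear maps on functions. *)
Definition act (X : mfield) (f : M -> R) : M -> R := fun p => X p [:: f].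

Definition op_field (T : (M -> R) -> (M -> R)) : mfield :=
  fun p fs => if fs is [:: f] then T f p else 0.

(* A mask splits a sequence into the subsequence of its selected items and that
   of its other items.  [inversions m] is the number of inversions of the
   corresponding shuffle: an unselected item preceding a selected one. *)
Fixpoint inversions (m : bitseq) : nat :=
  if m is b :: m' then ((if b then 0 else count id m') + inversions m')%N
  else 0%N.

Definition wedge (D E : mfield) : mfield := fun p fs =>
  \sum_(m : (size fs).-tuple bool)
     (-1) ^+ inversions m * D p (mask m fs) * E p (mask (map negb m) fs).

(** * The Hom-Schouten bracket *)

(* On degree 1 this is phi^* o X o (phi^* )^-1, on functions it is phi^*, and it is
   multiplicative: see the three lemmas below. *)
Definition Ad (phi : diffeo) (D : mfield) : mfield :=
  fun p fs => D (phi p) (map (pull (dinv phi)) fs).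

Lemma Ad_fun (phi : diffeo) f : Ad phi (fun_field f) = fun_field (pull phi f).
Proof. by apply/funext => p; apply/funext => -[]. Qed.

Lemma Ad_act (phi : diffeo) X :
  act (Ad phi X) = pull phi \o act X \o pull (dinv phi).
Proof. by []. Qed.

Lemma Ad_wedge (phi : diffeo) D E :
  Ad phi (wedge D E) = wedge (Ad phi D) (Ad phi E).
Proof.
apply/funext => p; apply/funext => fs; rewrite /Ad /wedge size_map.
by apply: eq_bigr => m _; rewrite !map_mask.
Qed.

Definition vector_bracket (phi : diffeo) (X Y : mfield) : mfield :=
  op_field (fun f =>
    (pull phi \o act X \o pull (dinv phi) \o act Y \o pull (dinv phi)) f
    - (pull phi \o act Y \o pull (dinv phi) \o act X \o pull (dinv phi)) f).

(* In the last three clauses D1, D2, D3 have degrees k, l, m.  The truncated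
   subtraction in the first one only matters for k = l = 0, where the bracket
   vanishes.  The sign exponents k + 1 and l + 1 of the last clause have the
   parities of k - 1 and l - 1. *)
Record hom_schouten (phi : diffeo) (B : mfield -> mfield -> mfield) : Prop :=
  HomSchouten {
  hs_degree : forall k l D1 D2, sections phi k D1 -> sections phi l D2 ->
    sections phi (k + l - 1) (B D1 D2);
  hs_linearl : forall k l (a : R) D D' E,
    sections phi k D -> sections phi k D' -> sections phi l E ->
    B (a *: D + D') E = a *: B D E + B D' E;
  hs_linearr : forall k l (a : R) D E E',
    sections phi k D -> sections phi l E -> sections phi l E' ->
    B D (a *: E + E') = a *: B D E + B D E';
  hs_vector : forall X Y, sections phi 1 X -> sections phi 1 Y ->
    B X Y = vector_bracket phi X Y;
  hs_fun : forall f g, Cinf f -> Cinf g -> B (fun_field f) (fun_field g) = 0;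
  hs_vector_fun : forall X f, sections phi 1 X -> Cinf f ->
    B X (fun_field f) = fun_field (act (Ad phi X) f);
  hs_leibniz : forall k l m D1 D2 D3,
    sections phi k D1 -> sections phi l D2 -> sections phi m D3 ->
    B D1 (wedge D2 D3) =
      wedge (B D1 D2) (Ad phi D3)
      + (-1) ^+ ((k + 1) * l) *: wedge (Ad phi D2) (B D1 D3);
  hs_skew : forall k l D1 D2, sections phi k D1 -> sections phi l D2 ->
    B D1 D2 = - ((-1) ^+ ((k + 1) * (l + 1)) *: B D2 D1) }.

(* [D1, D2]_(phi^* ) = E, for sections D1 and D2.  The axioms determine the bracket
   of two sections, but say nothing of [B] on other elements of the ambient type
   of fields, hence the definite description by all such [B]. *)
Definition hom_bracket_is (phi : diffeo) (D1 D2 E : mfield) : Prop :=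
  (exists B, hom_schouten phi B) /\
  (forall B, hom_schouten phi B -> B D1 D2 = E).

(** * Poisson and Hom-Poisson structures *)

(* For phi = id the axioms above are those of the Schouten bracket. *)
Definition poisson (pi : mfield) : Prop :=
  sections id 2 pi /\ hom_bracket_is diffeo_id pi pi 0.

Definition pushforward (phi : diffeo) (D : mfield) : mfield :=
  fun q fs => D (dinv phi q) (map (pull phi) fs).

Definition poisson_iso (pi : mfield) (phi : diffeo) : Prop :=
  pushforward phi pi = pi.

Definition hom_poisson (pi' : mfield) (phi : diffeo) : Prop :=
  [/\ sections phi 2 pi', hom_bracket_is phi pi' pi' 0 & Ad phi pi' = pi'].

Definition pullback_section (pi : mfield) (phi : diffeo) : mfield :=
  fun p => pi (phi p).

End Manifold.

(* Main.v *)
From mathcomp Require Import all_boot all_order all_algebra.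
From mathcomp Require Import all_classical all_reals all_analysis.
Require Import Defs.

(** A section of Lambda^k phi^! TM is a k-vector field composed with phi, so
    pi |-> pi^! is a bijection from bivector fields to sections of
    Lambda^2 phi^! TM; what has to be seen is that it matches the two sets of
    conditions.

    For the bracket, write a vector field as an operator on functions.  Then
    X^! = phi^* o X, hence
      [X^!, Y^!]_(phi^* ) = phi^* o phi^* o [X, Y] o (phi^* )^-1
                         = (Ad_(phi^* ) [X, Y])^!,
    and the same formula in all degrees turns the Schouten bracket into the
    Hom-Schouten bracket.  As D |-> (Ad_(phi^* ) D)^! is linear and bijective,
    [pi^!, pi^!]_(phi^* ) = 0 if and only if [pi, pi] = 0.

    The brackets are only given by their axioms.  Instead of constructing a
    bracket, [transfer_hom_schouten] carries any operation satisfying the axioms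
    for one diffeomorphism phi to an operation satisfying them for another one
    psi.  The two directions of the theorem are its cases (id, phi) and
    (phi, id); since the two transports are mutually inverse, both the existence
    of a bracket and the common value of all brackets go over, which is
    [hom_bracket_is_transport].

    For the invariance, Ad_(phi^* ) is the inverse of the push-forward of fields
    ([Ad_pushforward], [pushforward_Ad]) and commutes with pi |-> pi^!, so that
    phi_* pi = pi means Ad_(phi^* ) pi^! = pi^!.

    The transports act on sections because composition with a diffeomorphism
    preserves smooth functions ([Cinf_pull]), by the chain rule in charts
    ([Ck_comp]); hence it also maps tangent vectors to tangent vectors. *)

Set Implicit Arguments.
Unset Strict Implicit.
Unset Printing Implicit Defensive.
Import Order.TTheory GRing.Theory Num.Theory.
Import numFieldNormedType.Exports.
Local Open Scope classical_set_scope.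
Local Open Scope ring_scope.

(** * Calculus of C^k functions on R^n *)

Lemma near_eq_differentiable (R : numFieldType) (V W : normedModType R)
    (f g : V -> W) (x : V) :
  (\near x, f x = g x) -> differentiable f x -> differentiable g x.
Proof.
move=> fg /diff_locallyP[df fE]; apply/diff_locallyP.
have fgE : g \o shift x = cst (g x) + 'd f x +o_ 0 id.
  apply/eqaddoP => e e0.
  move/eqaddoP : fE => /(_ e e0); apply: filter_app.
  have fg0 : \forall y \near 0, f (y + x) = g (y + x).
    by move: fg; rewrite (near_shift 0) subr0.
  apply: filterS fg0 => y /= fgy.
  by rewrite !fctE /= fgy (nbhs_singleton fg).
by rewrite (diff_unique df fgE).
Qed.

Lemma near_eq_continuous (T U : topologicalType) (f g : T -> U) (x : T) :
  (\near x, f x = g x) -> {for x, continuous f} -> {for x, continuous g}.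
Proof.
move=> fg; rewrite /prop_for /continuous_at (nbhs_singleton fg).
by apply: cvg_trans; exact: near_eq_cvg.
Qed.

Section Calculus.
Context {R : realType} {n : nat}.
Implicit Types (U V : set 'rV[R]_n) (f g : 'rV[R]_n -> R).

(** Reduces statements on [U] to germs at its points: no neighbourhood of [x]
    inside [[set x]] is required, since the partial derivatives in [Ck] are
    those of the ambient function. *)
Lemma Ck_pointwise k U f :
  Ck k U f <-> forall x, U x -> Ck k [set x] f.
Proof.
elim: k f => [|k IHk] f /=.
  split=> [fU x Ux _ -> | fU x Ux]; first exact: fU.
  exact: (fU x Ux x erefl).
split=> [[df Df] x Ux | fU].
  by split=> [_ -> | i]; [exact: df | exact: (IHk _).1 (Df i) x Ux].
split=> [x Ux | i]; first exact: (fU x Ux).1.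
by apply/(IHk _).2 => x Ux; exact: (fU x Ux).2.
Qed.

Lemma sub_Ck k U V f : V `<=` U -> Ck k U f -> Ck k V f.
Proof. by move=> VU /Ck_pointwise fU; apply/Ck_pointwise => x /VU /fU. Qed.

Lemma near_eq_Ck k f g (x : 'rV[R]_n) :
  (\near x, f x = g x) -> Ck k [set x] f -> Ck k [set x] g.
Proof.
elim: k f g => [|k IHk] f g fg /=.
  by move=> fx _ ->; exact: near_eq_continuous fg (fx x erefl).
move=> [df Df]; split=> [_ -> | i].
  exact: near_eq_differentiable fg (df x erefl).
apply: IHk (Df i); move/nbhs_interior: fg; apply: filterS => y.
exact: near_eq_derive.
Qed.

Lemma eq_Ck k U f g : open U -> {in U, f =1 g} -> Ck k U f -> Ck k U g.
Proof.
move=> oU fg /Ck_pointwise fU; apply/Ck_pointwise => x Ux.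
apply: near_eq_Ck (fU x Ux).
by near=> y; apply: fg; rewrite inE; near: y; exact: open_nbhs_nbhs.
Unshelve. all: by end_near. Qed.

Lemma Ck_le k l U f : (k <= l)%N -> Ck l U f -> Ck k U f.
Proof.
elim: k l f => [|k IHk] [|l] f //= kl [df Df]; last first.
  by split=> // i; exact: IHk (Df i).
by move=> x Ux; exact/differentiable_continuous/df.
Qed.

Lemma Ck_cst k U (a : R) : Ck k U (cst a).
Proof.
elim: k a => [|k IHk] a /=; first by move=> x _; exact: cst_continuous.
split=> [x _|i]; first exact: differentiable_cst.
rewrite (_ : (fun _ => _) = cst 0) //.
by apply/funext => x; rewrite derive_cst.
Qed.

Lemma Ck_add k U f g : open U ->
  Ck k U f -> Ck k U g -> Ck k U (fun x => f x + g x).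
Proof.
move=> oU; elim: k f g => [|k IHk] f g /=.
  by move=> fU gU x Ux; exact: continuousD (fU x Ux) (gU x Ux).
move=> [df Df] [dg Dg]; split=> [x Ux|i].
  exact: differentiableD (df x Ux) (dg x Ux).
apply: eq_Ck (IHk _ _ (Df i) (Dg i)) => // x; rewrite inE => Ux.
by rewrite deriveD //; apply: diff_derivable; [exact: df | exact: dg].
Qed.

Lemma Ck_sum k U m (f : 'I_m -> 'rV[R]_n -> R) : open U ->
  (forall j, Ck k U (f j)) -> Ck k U (fun x => \sum_(j < m) f j x).
Proof.
move=> oU; elim: m f => [|m IHm] f fU.
  rewrite (_ : (fun _ => _) = cst 0); first exact: Ck_cst.
  by apply/funext => x; rewrite big_ord0.
rewrite (_ : (fun _ => _) =
    fun x => f ord0 x + \sum_(j < m) f (lift ord0 j) x); last first.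
  by apply/funext => x; rewrite big_ord_recl.
by apply: Ck_add => //; exact: IHm.
Qed.

Lemma Ck_mul k U f g : open U ->
  Ck k U f -> Ck k U g -> Ck k U (fun x => f x * g x).
Proof.
move=> oU; elim: k f g => [|k IHk] f g.
  by move=> fU gU x Ux; exact: continuousM (fU x Ux) (gU x Ux).
move=> fU gU; have [df Df] := fU; have [dg Dg] := gU.
split=> [x Ux|i]; first exact: differentiableM (df x Ux) (dg x Ux).
have fk := Ck_le (leqnSn k) fU; have gk := Ck_le (leqnSn k) gU.
have := Ck_add oU (IHk _ _ fk (Dg i)) (IHk _ _ gk (Df i)).
apply: eq_Ck => // x; rewrite inE => Ux.
by rewrite deriveM //; apply: diff_derivable; [exact: df | exact: dg].
Qed.

Lemma continuous_rV (T : topologicalType) m (h : T -> 'rV[R]_m) x :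
  (forall j, {for x, continuous (fun y => h y 0 j)}) ->
  {for x, continuous h}.
Proof.
move=> hc; apply/cvgrPdist_le => e e0; near=> y.
rewrite [leLHS]/Num.Def.normr/= mx_normrE (bigmax_le _ (ltW e0))//= => -[i j] _.
rewrite !mxE ord1 {i} /=; move: j; near: y.
by apply: filter_forall => j; exact: (cvgrPdist_le _ _).1 (hc j) e e0.
Unshelve. all: by end_near. Qed.

Lemma differentiable_rV m (h : 'rV[R]_n -> 'rV[R]_m) x :
  (forall j, differentiable (fun y => h y 0 j) x) -> differentiable h x.
Proof.
move=> dh; rewrite (_ : h = \sum_(j < m) fun y => h y 0 j *: delta_mx 0 j).
  by apply: differentiable_sum => j; exact: differentiableZl.
by apply/funext => y; rewrite fct_sumE [LHS]row_sum_delta.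
Qed.

Lemma derive_comp_rV m (g : 'rV[R]_m -> R) (h : 'rV[R]_n -> 'rV[R]_m) x v :
  differentiable h x -> differentiable g (h x) ->
  'D_v (g \o h) x =
  \sum_(j < m) 'D_(delta_mx 0 j) g (h x) * 'D_v (fun y => h y 0 j) x.
Proof.
move=> dh dg.
rewrite deriveE; last exact: differentiable_comp.
rewrite diff_comp //= -(deriveE v dh) derive_mx; last exact: diff_derivable.
rewrite [X in 'd g _ X]row_sum_delta linear_sum; apply: eq_bigr => j _.
by rewrite linearZ mxE -(deriveE _ dg) [RHS]mulrC.
Qed.

(** Induction on the order: by the chain rule the partial derivatives of
    [g \o h] on [U] are sums of products of functions [('D_j g) \o h], covered
    by the induction hypothesis, and of partial derivatives of [h]. *)
Lemma Ck_comp k m U (V : set 'rV[R]_m) (g : 'rV[R]_m -> R)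
    (h : 'rV[R]_n -> 'rV[R]_m) :
  open U -> h @` U `<=` V -> Ck k V g ->
  (forall j, Ck k U (fun x => h x 0 j)) -> Ck k U (g \o h).
Proof.
move=> oU hUV; have hV x : U x -> V (h x) by move=> Ux; apply: hUV; exists x.
elim: k g => [|k IHk] g gV hU.
  move=> x Ux; apply: continuous_comp (gV _ (hV x Ux)).
  by apply: continuous_rV => j; exact: hU.
have [dg Dg] := gV; have dh x : U x -> differentiable h x.
  by move=> Ux; apply: differentiable_rV => j; exact: (hU j).1.
split=> [x Ux|i].
  by apply: differentiable_comp; [exact: dh | exact/dg/hV].
have hk j := Ck_le (leqnSn k) (hU j).
apply: (@eq_Ck _ _ (fun x => \sum_(j < m)
  ('D_(delta_mx 0 j) g \o h) x * 'D_(delta_mx 0 i) (fun y => h y 0 j) x)) => //.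
  move=> x; rewrite inE => Ux; rewrite derive_comp_rV //; first exact: dh.
  exact/dg/hV.
apply: Ck_sum => // j; apply: Ck_mul => //; last exact: (hU j).2.
exact: IHk (Dg j) hk.
Qed.
End Calculus.

(** * Smooth functions and diffeomorphisms *)

Section Manifold.
Context {R : realType} {n : nat} {M : manifold R n}.
Implicit Types (f g : M -> R) (a b s : M -> M) (phi psi : diffeo M).
Implicit Types (c : chart R n M) (k l m : nat).
Local Notation mfield := (M -> seq (M -> R) -> R).

Lemma open_chart_image c (V : set M) :
  is_chart c -> open V -> open (cfun c @` (cdom c `&` V)).
Proof.
move=> cM oV.
have : open ((cfun c @` cdom c) `&` (cinv c @^-1` V)).
  have oU := chart_open_img cM; apply: (continuous_inP _ oU).1 oV.
  by rewrite -continuous_open_subspace //; exact: chart_inv_cts.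
congr open; apply/seteqP; split=> [_ [[p cp <-] Vp] | _ [p [cp Vp] <-]].
  by exists p => //; split=> //; rewrite -(chart_cancel cM cp).
by split; [exists p | rewrite /= chart_cancel].
Qed.

(** Near a point of the chart [c], in a chart [c'] around the image point,
    [f \o a] is the composite of the local expressions of [f] and of [a].  The
    open set [W] on which this holds depends on the point, whence the reduction
    to single points. *)
Lemma Cinf_pull a f : smooth_map a -> Cinf f -> Cinf (pull a f).
Proof.
move=> [ac asm] fM c cM k; apply/Ck_pointwise => _ [p cp <-].
have [c' c'M c'p] := atlas_cover (a p).
have [cC c'C] := (atlas_chart cM, atlas_chart c'M).
set W := cfun c @` (cdom c `&` a @^-1` cdom c').
have oW : open W.
  apply: open_chart_image => //.
  by apply: open_comp => [x _|]; [exact: ac | exact: chart_open_dom].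
apply: (@sub_Ck _ _ _ W); first by move=> _ ->; exists p.
apply: (@eq_Ck _ _ _ _
  ((f \o cinv c') \o (cfun c' \o a \o cinv c))) => //.
  move=> x; rewrite inE => -[q [cq c'q] <-] /=.
  by rewrite /pull /= !(chart_cancel cC cq) (chart_cancel c'C).
apply: Ck_comp (fM c' c'M k) _ => //; last by move=> j; exact: asm.
by move=> _ [_ [q [cq c'q] <-] <-] /=; exists (a q); rewrite //= chart_cancel.
Qed.

Lemma pull_dinvK phi : cancel (pull (dinv phi)) (@pull R n M phi).
Proof. by move=> f; apply/funext => p; rewrite /pull /= dfunK. Qed.

Lemma pull_dfunK phi : cancel (@pull R n M phi) (pull (dinv phi)).
Proof. by move=> f; apply/funext => p; rewrite /pull /= dinvK. Qed.

Lemma Cinf_pull_dfun phi f : Cinf (pull phi f) <-> Cinf f.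
Proof.
split=> [|/Cinf_pull]; last by apply; exact: dfun_smooth.
by move=> /(Cinf_pull (dinv_smooth phi)); rewrite pull_dfunK.
Qed.

Lemma Cinf_pull_dinv phi f : Cinf (pull (dinv phi) f) <-> Cinf f.
Proof. by rewrite -(Cinf_pull_dfun phi) pull_dinvK. Qed.

(** * Moving fields by diffeomorphisms *)

Definition Cinf_compatible b := forall f, Cinf (pull b f) <-> Cinf f.

(** The push-forward along [b].  Smoothness must be reflected as well as
    preserved, because tangent vectors vanish off [Cinf]. *)
Lemma tangent_push b p v : Cinf_compatible b ->
  tangent p v -> tangent (b p) (v \o pull b).
Proof.
move=> bM [lv mv v0]; split=> [a f g fM gM | f g fM gM | f nf] /=.
- by apply: lv; apply/bM.
- by apply: mv; apply/bM.
- by apply: v0 => /bM.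
Qed.

Lemma ext_power_push k b p P : Cinf_compatible b ->
  ext_power k p P -> ext_power k (b p) (P \o map (pull b)).
Proof.
move=> bM [N [a [v [tv ->]]]].
exists N, a, (fun (t : 'I_N) i => v t i \o pull b); split=> [t i|].
  exact: tangent_push.
apply/funext => fs /=; apply: eq_bigr => t _; congr (_ * _).
rewrite /wedge_vectors size_map; case: eqP => // sfs; congr (\det _).
by apply/matrixP => i j; rewrite !mxE (nth_map (cst 0)) ?sfs.
Qed.

(** Substitution in the base point and in the covectors separately: [Ad], the
    push-forward and the pull-back of sections are all of this form. *)
Definition move_field a b (D : mfield) : mfield :=
  fun p fs => D (a p) (map (pull b) fs).

Lemma move_field_id a D : move_field a id D = D \o a.
Proof. by apply/funext => p; apply/funext => fs; rewrite /move_field map_id. Qed.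

Lemma move_field_comp a b a' b' D :
  move_field a' b' (move_field a b D) = move_field (a \o a') (b' \o b) D.
Proof.
by apply/funext => p; apply/funext => fs; rewrite /move_field /= -map_comp.
Qed.

Lemma wedge_move a b D E :
  move_field a b (wedge D E) = wedge (move_field a b D) (move_field a b E).
Proof.
apply/funext => p; apply/funext => fs; rewrite /move_field /wedge size_map.
by apply: eq_bigr => m _; rewrite !map_mask.
Qed.

(** A value of [D] at [a p] lives over [chi (a p)], and [b] pushes it forward to
    [b (chi (a p))]. *)
Lemma sections_move chi chi' k a b D :
  Cinf_compatible a -> Cinf_compatible b -> b \o chi \o a = chi' ->
  sections chi k D -> sections chi' k (move_field a b D).
Proof.
move=> aM bM <- [eD sD]; split=> [p|fs sfs fM] /=.
  exact: ext_power_push.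
apply/(aM (fun q => D q (map (pull b) fs))); apply: sD.
  by rewrite size_map.
by move=> i ik; rewrite (nth_map (cst 0)) ?sfs //; apply/bM/fM.
Qed.

Lemma sections_comp chi chi' k s D : Cinf_compatible s -> chi \o s = chi' ->
  sections chi k D -> sections chi' k (D \o s).
Proof. by rewrite -move_field_id => sM; apply: sections_move. Qed.

(** * Transport of Hom-Schouten brackets *)

(** Sections along psi become sections along phi by composition with
    psi^-1 o phi, since psi o (psi^-1 o phi) = phi. *)
Definition twist phi psi : M -> M := dinv psi \o phi.

(** The correction that the values of brackets undergo on their way from phi
    back to psi.  With s = psi^-1 o phi, the Leibniz rule for phi at D1 o s,
    D2 o s and D3 o s has the factors Ad_(phi^* ) (D2 o s) and
    Ad_(phi^* ) (D3 o s), which have to become Ad_(psi^* ) D2 and Ad_(psi^* ) D3.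
    On base points this asks for s o phi o a = psi, that is a = phi^-2 o psi^2,
    and on functions for f o b o phi^-1 = f o psi^-1, that is b = s.  For
    phi = id it is D |-> (Ad_(psi^* ) D)^!. *)
Definition transport phi psi : mfield -> mfield :=
  move_field (dinv phi \o dinv phi \o psi \o psi) (twist phi psi).

Definition transfer phi psi (B : mfield -> mfield -> mfield) D1 D2 :=
  transport phi psi (B (D1 \o twist phi psi) (D2 \o twist phi psi)).

Lemma Cinf_twist phi psi : Cinf_compatible (twist phi psi).
Proof.
move=> f; rewrite -[pull _ _]/(pull phi (pull (dinv psi) f)).
by rewrite Cinf_pull_dfun Cinf_pull_dinv.
Qed.

Lemma twistK phi psi : psi \o twist phi psi = phi.
Proof. by apply/funext => p; rewrite /twist /= dinvK. Qed.

Lemma sections_twist phi psi k D :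
  sections psi k D -> sections phi k (D \o twist phi psi).
Proof. by apply: sections_comp; [exact: Cinf_twist | exact: twistK]. Qed.

Lemma sections_transport phi psi k D :
  sections phi k D -> sections psi k (transport phi psi D).
Proof.
apply: sections_move; last 1 first.
- by apply/funext => p; rewrite /twist /= !dinvK dfunK.
- move=> f; rewrite -[pull _ _]/
    (pull psi (pull psi (pull (dinv phi) (pull (dinv phi) f)))).
  by rewrite !Cinf_pull_dfun !Cinf_pull_dinv.
- exact: Cinf_twist.
Qed.

Lemma transportK phi psi : cancel (transport phi psi) (transport psi phi).
Proof.
move=> D; rewrite /transport move_field_comp.
rewrite [X in move_field X](_ : _ = id); last first.
  by apply/funext => p; rewrite /= !(dfunK, dinvK).
rewrite [X in move_field _ X](_ : _ = id) ?move_field_id //.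
by apply/funext => p; rewrite /twist /= !(dfunK, dinvK).
Qed.

Lemma transport_Ad phi psi D :
  transport phi psi (Ad phi (D \o twist phi psi)) = Ad psi D.
Proof.
apply/funext => p; apply/funext => fs.
rewrite /transport /move_field /Ad /twist /= -map_comp !dinvK dfunK.
congr (D _ _); apply: eq_map => f.
by apply/funext => q; rewrite /pull /= dinvK.
Qed.

Lemma pull_dinv_twist phi psi f :
  pull (dinv phi) (pull (twist phi psi) f) = pull (dinv psi) f.
Proof. by apply/funext => p; rewrite /pull /twist /= dinvK. Qed.

(** In [vector_bracket] the factors (phi^* )^-1 absorb the composition with
    psi^-1 o phi, which leaves (psi^* )^-1; the outermost phi^* becomes psi^* by
    the choice of the base point map in [transport]. *)
Lemma transport_vector_bracket phi psi X Y :
  transport phi psi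
    (vector_bracket phi (X \o twist phi psi) (Y \o twist phi psi)) =
  vector_bracket psi X Y.
Proof.
apply/funext => p; apply/funext => -[|f [|g fs]] //.
have act_twist Z h :
  act (Z \o twist phi psi) h = pull (twist phi psi) (act Z h) by [].
rewrite /transport /move_field /vector_bracket /= !pull_dinv_twist !act_twist.
by rewrite !pull_dinv_twist !fctE /pull /twist /= !dinvK dfunK.
Qed.

Lemma transport_linear phi psi (a : R) D E :
  transport phi psi (a *: D + E) =
  a *: transport phi psi D + transport phi psi E.
Proof. by []. Qed.

(** [transport phi psi] is linear and multiplicative for [wedge], and maps
    Ad_(phi^* ) (D o s) to Ad_(psi^* ) D for s = psi^-1 o phi; each axiom for phi
    at arguments of the form D o s thus becomes the same axiom for psi at D. *)
Lemma transfer_hom_schouten phi psi B :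
  hom_schouten phi B -> hom_schouten psi (transfer phi psi B).
Proof.
move=> [degB linlB linrB vecB funB vecfunB leibB skewB].
have S k D := @sections_twist phi psi k D.
have fun_twist f :
  fun_field f \o twist phi psi = fun_field (pull (twist phi psi) f) by [].
have fT f : Cinf f -> Cinf (pull (twist phi psi) f).
  by move=> fM; apply/Cinf_twist.
split.
- move=> k l D1 D2 /S s1 /S s2; exact/sections_transport/degB.
- move=> k l a D D' E /S sD /S sD' /S sE.
  by rewrite /transfer -transport_linear -(linlB k l).
- move=> k l a D E E' /S sD /S sE /S sE'.
  by rewrite /transfer -transport_linear -(linrB k l).
- by move=> X Y /S sX /S sY; rewrite /transfer vecB // transport_vector_bracket.
- by move=> f g /fT fM /fT gM; rewrite /transfer !fun_twist funB.
- move=> X f /S sX /fT fM; rewrite /transfer fun_twist vecfunB //.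
  rewrite -(transport_Ad phi psi).
  by apply/funext => p; apply/funext => -[].
- move=> k l m D1 D2 D3 /S s1 /S s2 /S s3; rewrite /transfer.
  rewrite (leibB k l m _ _ _ s1 s2 s3) addrC transport_linear.
  by rewrite /transport !wedge_move -!/(transport _ _ _) !transport_Ad addrC.
- move=> k l D1 D2 /S s1 /S s2.
  by rewrite /transfer {1}(skewB k l _ _ s1 s2).
Qed.

(** A bracket for psi is obtained from one for phi, whereas the values of an
    arbitrary bracket for psi are computed by transferring it to phi: both
    directions of the transfer are used. *)
Lemma hom_bracket_is_transport phi psi D1 D2 E :
  hom_bracket_is phi D1 D2 E ->
  hom_bracket_is psi (D1 \o twist psi phi) (D2 \o twist psi phi)
    (transport phi psi E).
Proof.
move=> [[B hB] uB]; split.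
  by exists (transfer phi psi B); exact: transfer_hom_schouten.
by move=> B' /(@transfer_hom_schouten psi phi)/uB <-; rewrite transportK.
Qed.

(** * The correspondence *)

Lemma Ad_pushforward phi D : Ad phi (pushforward phi D) = D.
Proof.
apply/funext => p; apply/funext => fs.
by rewrite /Ad /pushforward dfunK -map_comp (eq_map (pull_dinvK phi)) map_id.
Qed.

Lemma pushforward_Ad phi D : pushforward phi (Ad phi D) = D.
Proof.
apply/funext => p; apply/funext => fs.
by rewrite /Ad /pushforward dinvK -map_comp (eq_map (pull_dfunK phi)) map_id.
Qed.

Lemma poisson_isoE (pi : mfield) phi : poisson_iso pi phi <-> Ad phi pi = pi.
Proof.
rewrite /poisson_iso; split=> [{1}<- | {1}<-].
  exact: Ad_pushforward.
exact: pushforward_Ad.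
Qed.

Lemma Ad_pullback_section phi (pi : mfield) :
  Ad phi (pullback_section pi phi) = pullback_section (Ad phi pi) phi.
Proof. by []. Qed.

End Manifold.

Theorem theorem3p1 (R : realType) (n : nat) (M : manifold R n) :
  set_bij
    [set x : (M -> seq (M -> R) -> R) * diffeo M |
       poisson x.1 /\ poisson_iso x.1 x.2]
    [set y : (M -> seq (M -> R) -> R) * diffeo M | hom_poisson y.1 y.2]
    (fun x => (pullback_section x.1 x.2, x.2)).
Proof.
split=> [[pi phi] /= [[s hb] /poisson_isoE iso]
  |[pi phi] [pi' phi'] _ _ /= [e ephi] | [pi phi] /= [s hb Adpi]].
- split=> /=.
  + exact: (@sections_twist _ _ _ phi (diffeo_id M) 2 pi s).
  + exact: (hom_bracket_is_transport phi hb).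
  + by rewrite Ad_pullback_section iso.
- case: _ / ephi in e *; congr pair; apply/funext => p.
  by have := congr1 (@^~ (dinv phi p)) e; rewrite /pullback_section /= dinvK.
- have piK : pullback_section (pi \o dinv phi) phi = pi.
    by apply/funext => p; rewrite /pullback_section /= dfunK.
  exists (pi \o dinv phi, phi) => /=; last by rewrite piK.
  split; last first.
    apply/poisson_isoE; rewrite -[in RHS]Adpi.
    by apply/funext => p; apply/funext => fs; rewrite /Ad /= dfunK dinvK.
  split; first exact: (@sections_twist _ _ _ (diffeo_id M) phi 2 pi s).
  exact: (hom_bracket_is_transport (diffeo_id M) hb).
Qed.
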